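(* Let $\mathcal{G}$ be a connected groupoid, $x\in\mathcal{G}_0$, $\tau(x)=\{\tau_y\}_{y\in\mathcal{G}_0}$ a transversal for $x$, $A$ a ring, $\gamma=(I,\gamma_{\tau(x)},\gamma_{(x)})$ an object of $\mathsf{D}_{\mathcal{G},\tau(x)}(A)$, and $\theta=\mathtt{Ext}(\gamma)$. Assume that $I_y$ is a unital ring for all $y\in\mathcal{G}_0$. Then the partial groupoid action $\theta$ of $\mathcal{G}$ on $A$ is globalizable if and only if the partial group action $\gamma_{(x)}$ of $\mathcal{G}(x)$ on $I_x$ is globalizable and $I_{\tau_y^{-1}}$ is a unital ring for all $y\in\mathcal{G}_0$.
   Context: Rings are associative and not necessarily unital; ideals are two-sided. A groupoid $\mathcal{G}$ is a small category in which every morphism is an isomorphism; $g\in\mathcal{G}$ means $g$ is a morphism; $\mathcal{G}_0$ is the set of objects, each object being identified with its identity morphism; $s(g),t(g)$ are source and target; composition is written right to left, so $gh$ is defined iff $s(g)=t(h)$. $\mathcal{G}(x,y)=\{g\in\mathcal{G}: s(g)=x,\ t(g)=y\}$ and $\mathcal{G}(x)=\mathcal{G}(x,x)$. $\mathcal{G}$ is connected if $\mathcal{G}(x,y)\neq\emptyset$ for all $x,y\in\mathcal{G}_0$. A partial action of $\mathcal{G}$ on a ring $A$ is a family $\alpha=(A_g,\alpha_g)_{g\in\mathcal{G}}$ such that: (P1) for each $g$, $A_{t(g)}$ is an ideal of $A$, $A_g$ is an ideal of $A_{t(g)}$ and $\alpha_g:A_{g^{-1}}\to A_g$ is a ring isomorphism;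 (P2) $\alpha_x=\mathrm{id}_{A_x}$ for $x\in\mathcal{G}_0$; (P3) $\alpha_h^{-1}(A_{g^{-1}}\cap A_h)\subseteq A_{(gh)^{-1}}$ whenever $s(g)=t(h)$; (P4) $\alpha_g(\alpha_h(a))=\alpha_{gh}(a)$ for all $a\in\alpha_h^{-1}(A_{g^{-1}}\cap A_h)$ whenever $s(g)=t(h)$. The partial action is global if $\alpha_g\alpha_h=\alpha_{gh}$ whenever $s(g)=t(h)$ (equivalently $A_g=A_{t(g)}$ for all $g$). A partial action of a group $H$ on a ring $I$ is a partial action of $H$ viewed as a one-object groupoid, the ideal attached to the identity of $H$ being $I$ itself. A globalization of $\alpha=(A_g,\alpha_g)_{g\in\mathcal{G}}$ is a pair $(B,\beta)$, $B$ a ring and $\beta=(B_g,\beta_g)_{g\in\mathcal{G}}$ a global action of $\mathcal{G}$ on $B$, such that: (G1) $A_x$ is an ideal of $B_x$ for each $x\in\mathcal{G}_0$; (G2) $A_g=A_{t(g)}\cap\beta_g(A_{s(g)})$ for all $g$; (G3) $\beta_g(a)=\alpha_g(a)$ for all $a\in A_{g^{-1}}$; (G4) $B_g=\sum_{t(h)=t(g)}\beta_h(A_{s(h)})$ for all $g$. $\alpha$ is globalizable if it admits a globalization; for partial group actions this is applied to the one-object groupoid. A transversal for $x\in\mathcal{G}_0$ is a family $\tau(x)=\{\tau_y\}_{y\in\mathcal{G}_0}$ with $\tau_y\in\mathcal{G}(x,y)$ and $\tau_x=x$. For $g\in\mathcal{G}$ put $g_x:=\tau_{t(g)}^{-1}g\tau_{s(g)}\in\mathcal{G}(x)$.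 Composition of partial bijections $f:X\to Y$, $f':X'\to Y'$ of a set is $f'f:f^{-1}(X'\cap Y)\to f'(X'\cap Y)$. An object of $\mathsf{D}_{\mathcal{G},\tau(x)}(A)$ is a triple $(I,\gamma_{\tau(x)},\gamma_{(x)})$ where: $I=\{I_y\}_{y\in\mathcal{G}_0}$ is a family of ideals of $A$; $\gamma_{\tau(x)}=\{\gamma_{\tau_y}:I_{\tau_y^{-1}}\to I_{\tau_y}\}_{y\in\mathcal{G}_0}$ is a family of ring isomorphisms with $I_{\tau_y^{-1}}$ an ideal of $I_x$, $I_{\tau_y}$ an ideal of $I_y$, and $\gamma_{\tau_x}=\gamma_x=\mathrm{id}_{I_x}$; $\gamma_{(x)}=(I_h,\gamma_h)_{h\in\mathcal{G}(x)}$ is a partial action of the group $\mathcal{G}(x)$ on $I_x$; and for all $g\in\mathcal{G}$ the set $\gamma_{\tau_{t(g)}}\big(I_{\tau_{t(g)}^{-1}}\cap\gamma_{g_x}(I_{\tau_{s(g)}^{-1}}\cap I_{g_x^{-1}})\big)$ is an ideal of $I_{t(g)}$. $\mathtt{Ext}(\gamma)$ is the partial action $\theta=(B_g,\theta_g)_{g\in\mathcal{G}}$ of $\mathcal{G}$ on $A$ with $\theta_y=\mathrm{id}_{I_y}$ for $y\in\mathcal{G}_0$, $\theta_g=\gamma_{\tau_{t(g)}}\gamma_{g_x}\gamma_{\tau_{s(g)}}^{-1}$ (composition of partial bijections) for $g\notin\mathcal{G}_0$, and $B_g$ the range of $\theta_g$. *)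

(* Defs.v *)
From HB Require Import structures.
From mathcomp Require Import all_boot all_order all_algebra.
From mathcomp Require Import boolp classical_sets functions.

Set Implicit Arguments.
Unset Strict Implicit.
Unset Printing Implicit Defensive.
Import GRing.Theory.
Local Open Scope classical_set_scope.
Local Open Scope ring_scope.

(* MathComp's pzRingType and its extensions all carry a unit, so rings without
   unit are introduced here on top of zmodType. *)
HB.mixin Record Zmodule_isRng R of GRing.Zmodule R := {
  rmul : R -> R -> R;
  rmulA : associative rmul;
  rmulDl : left_distributive rmul +%R;
  rmulDr : right_distributive rmul +%R
}.

#[short(type="rngType")]
HB.structure Definition Rng := {R of Zmodule_isRng R & GRing.Zmodule R}.

Notation "x ** y" := (rmul x y) (at level 40, left associativity) : ring_scope.

(* Ideals, and rings that are ideals of a given ring, are represented as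
   subsets of an ambient ring; [J] is a two-sided ideal of the ring [R]. *)
Definition ideal_of (A : rngType) (J R : set A) : Prop :=
  [/\ J `<=` R,
      J 0,
      forall a b, J a -> J b -> J (a - b) &
      forall r a, R r -> J a -> J (r ** a) /\ J (a ** r)].

Definition unital (A : rngType) (J : set A) : Prop :=
  exists2 e, J e & forall a, J a -> e ** a = a /\ a ** e = a.

(* Only the values of [f] on [X] matter, here and for all partially defined
   maps below. *)
Definition ring_hom_on (A B : rngType) (X : set A) (f : A -> B) : Prop :=
  forall a b, X a -> X b ->
    f (a + b) = f a + f b /\ f (a ** b) = f a ** f b.

Definition ring_iso (A B : rngType) (X : set A) (Y : set B) (f : A -> B) :=
  set_bij X Y f /\ ring_hom_on X f.

(* The sum of a family of additive subgroups with union [S]. *)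
Definition sum_of (B : rngType) (S : set B) : set B :=
  [set b | exists2 r : seq B,
             (forall c, c \in r -> S c) & b = \sum_(c <- r) c].

Record partmap (T : Type) := PartMap { pdom : set T; pfun : T -> T }.

Definition prange T (f : partmap T) : set T := pfun f @` pdom f.

Definition pid T (X : set T) : partmap T := PartMap X id.

Definition pmap_comp T (f' f : partmap T) : partmap T :=
  PartMap (pdom f `&` pfun f @^-1` (pdom f' `&` prange f)) (pfun f' \o pfun f).

(* The inverse of an injective partial map. *)
Definition pinverse (A : rngType) (f : partmap A) : partmap A :=
  PartMap (prange f) ('pinv_(fun=> 0) (pdom f) (pfun f)).

Definition pmap_eq T (f f' : partmap T) : Prop :=
  pdom f = pdom f' /\ {in pdom f, pfun f =1 pfun f'}.

Record groupoid := Groupoid {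
  obj :> Type;
  mor : obj -> obj -> Type; (* [mor x y]: source [x], target [y] *)
  idmor : forall x, mor x x;
  compm : forall x y z, mor y z -> mor x y -> mor x z;
  minv : forall x y, mor x y -> mor y x;
  compmA : forall w x y z (f : mor y z) (g : mor x y) (h : mor w x),
    compm f (compm g h) = compm (compm f g) h;
  comp1m : forall x y (g : mor x y), compm (idmor y) g = g;
  compm1 : forall x y (g : mor x y), compm g (idmor x) = g;
  compVm : forall x y (g : mor x y), compm (minv g) g = idmor x;
  compmV : forall x y (g : mor x y), compm g (minv g) = idmor y
}.

Arguments mor {G} x y : rename.
Arguments idmor {G} x : rename.

Definition connected_groupoid (G : groupoid) : Prop :=
  forall x y : G, inhabited (mor x y).

Inductive is_identity (G : groupoid) : forall x y : G, mor x y -> Prop :=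
  IsIdentity x : is_identity (idmor x).

(* The group of endomorphisms of [x], as a groupoid with one object. *)
Definition vertex_group (G : groupoid) (x : G) : groupoid :=
  @Groupoid unit (fun _ _ => mor x x) (fun _ => idmor x)
    (fun _ _ _ g h => compm g h) (fun _ _ g => minv g)
    (fun _ _ _ _ f g h => compmA f g h)
    (fun _ _ g => comp1m g) (fun _ _ g => compm1 g)
    (fun _ _ g => compVm g) (fun _ _ g => compmV g).

Record obj_transversal (G : groupoid) (x : G) := ObjTransversal {
  tr :> forall y : G, mor x y;
  tr_base : tr x = idmor x
}.

(* [g_x = tau_{t(g)}^{-1} g tau_{s(g)}] *)
Definition to_vertex (G : groupoid) (x : G) (tau : obj_transversal x)
    (y z : G) (g : mor y z) : mor x x :=
  compm (minv (tau z)) (compm g (tau y)).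

(* The data [(A_g, alpha_g)_g]; only the values of [amap g] on
   [aset (minv g)] are relevant. *)
Record action_data (G : groupoid) (A : Type) := ActionData {
  aset : forall x y : G, mor x y -> set A;
  amap : forall x y : G, mor x y -> A -> A
}.

Definition act_pmap (G : groupoid) (A : Type) (alpha : action_data G A)
    (x y : G) (g : mor x y) : partmap A :=
  PartMap (aset alpha (minv g)) (amap alpha g).

(* [A_x], for an object [x] *)
Definition oset (G : groupoid) (A : Type) (alpha : action_data G A) (x : G) :
  set A := aset alpha (idmor x).

(* [alpha_h^{-1}(A_{g^{-1}} \cap A_h)] *)
Definition comp_dom (G : groupoid) (A : Type) (alpha : action_data G A)
    (x y z : G) (g : mor y z) (h : mor x y) : set A :=
  aset alpha (minv h) `&`
    amap alpha h @^-1` (aset alpha (minv g) `&` aset alpha h).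

(* [alpha] is a partial action of [G] on the ring [R], where [R] is a subring
   of the ambient ring [A] ([R = setT] for a partial action on [A] itself). *)
Record partial_action (G : groupoid) (A : rngType) (R : set A)
    (alpha : action_data G A) : Prop := PartialAction {
  pa_object : forall x, ideal_of (oset alpha x) R;
  pa_ideal : forall (x y : G) (g : mor x y),
    ideal_of (aset alpha g) (oset alpha y);
  pa_iso : forall (x y : G) (g : mor x y),
    ring_iso (aset alpha (minv g)) (aset alpha g) (amap alpha g);
  pa_id : forall x a, oset alpha x a -> amap alpha (idmor x) a = a;
  pa_dom : forall (x y z : G) (g : mor y z) (h : mor x y),
    comp_dom alpha g h `<=` aset alpha (minv (compm g h));
  pa_comp : forall (x y z : G) (g : mor y z) (h : mor x y) a,
    comp_dom alpha g h a ->
    amap alpha g (amap alpha h a) = amap alpha (compm g h) a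
}.

Definition global_action (G : groupoid) (B : rngType)
    (beta : action_data G B) : Prop :=
  partial_action setT beta /\
  forall (x y z : G) (g : mor y z) (h : mor x y),
    pmap_eq (pmap_comp (act_pmap beta g) (act_pmap beta h))
            (act_pmap beta (compm g h)).

(* The ring [A_x] is regarded as a subset of [B] through the embedding
   [iota x : A_x -> B]. As is usual for groupoid actions the identification is
   made separately for each object [x]. *)
Record globalization (G : groupoid) (A : rngType) (alpha : action_data G A)
    (B : rngType) (beta : action_data G B) (iota : G -> A -> B) : Prop :=
  Globalization {
  gl_global : global_action beta;
  gl_embed : forall x,
    ring_iso (oset alpha x) (iota x @` oset alpha x) (iota x);
  gl_ideal : forall x, ideal_of (iota x @` oset alpha x) (oset beta x);
  gl_inter : forall (x y : G) (g : mor x y),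
    iota y @` aset alpha g =
      (iota y @` oset alpha y) `&` (amap beta g @` (iota x @` oset alpha x));
  gl_extend : forall (x y : G) (g : mor x y) a,
    aset alpha (minv g) a -> amap beta g (iota x a) = iota y (amap alpha g a);
  gl_sum : forall (x y : G) (g : mor x y),
    aset beta g =
      sum_of [set b | exists (z : G) (h : mor z y),
                        (amap beta h @` (iota z @` oset alpha z)) b]
}.

Definition globalizable (G : groupoid) (A : rngType)
    (alpha : action_data G A) : Prop :=
  exists (B : rngType) (beta : action_data G B) (iota : G -> A -> B),
    globalization alpha beta iota.

Definition vset (G : groupoid) (x : G) (A : Type)
    (alpha : action_data (vertex_group x) A) (h : mor x x) : set A :=
  @aset (vertex_group x) A alpha tt tt h.

Definition vact (G : groupoid) (x : G) (A : Type)
    (alpha : action_data (vertex_group x) A) (h : mor x x) : A -> A :=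
  @amap (vertex_group x) A alpha tt tt h.

Definition vpmap (G : groupoid) (x : G) (A : Type)
    (alpha : action_data (vertex_group x) A) (h : mor x x) : partmap A :=
  @act_pmap (vertex_group x) A alpha tt tt h.

Record D_object (G : groupoid) (x : G) (tau : obj_transversal x) (A : rngType) :=
  DObject {
  (* the ideals [I_y] *)
  Iset : G -> set A;
  (* [I_{tau_y^{-1}}], [I_{tau_y}] and [gamma_{tau_y}] *)
  tdom : G -> set A;
  tcod : G -> set A;
  tmap : G -> A -> A;
  (* [gamma_{(x)}] *)
  vdata : action_data (vertex_group x) A;
  Iset_ideal : forall y, ideal_of (Iset y) setT;
  tdom_ideal : forall y, ideal_of (tdom y) (Iset x);
  tcod_ideal : forall y, ideal_of (tcod y) (Iset y);
  tmap_iso : forall y, ring_iso (tdom y) (tcod y) (tmap y);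
  tdom_base : tdom x = Iset x;
  tcod_base : tcod x = Iset x;
  tmap_base : forall a, Iset x a -> tmap x a = a;
  vdata_action : partial_action (Iset x) vdata;
  vdata_base : vset vdata (idmor x) = Iset x;
  D_ideal : forall (y z : G) (g : mor y z),
    ideal_of
      (tmap z @`
         (tdom z `&`
            (vact vdata (to_vertex tau g) @`
               (tdom y `&` vset vdata (minv (to_vertex tau g))))))
      (Iset z)
}.

Definition tpmap (G : groupoid) (x : G) (tau : obj_transversal x) (A : rngType)
    (gamma : D_object tau A) (y : G) : partmap A :=
  PartMap (tdom gamma y) (tmap gamma y).

(* Identities are treated apart: for [g = idmor y] the composite below is only
   the identity of [I_{tau_y}], which may be smaller than [I_y]. *)
Definition Ext_pmap (G : groupoid) (x : G) (tau : obj_transversal x) (A : rngType)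
    (gamma : D_object tau A) (y z : G) (g : mor y z) : partmap A :=
  if pselect (is_identity g) then pid (Iset gamma y)
  else pmap_comp (tpmap gamma z)
         (pmap_comp (vpmap (vdata gamma) (to_vertex tau g))
                (pinverse (tpmap gamma y))).

Definition Ext (G : groupoid) (x : G) (tau : obj_transversal x) (A : rngType)
    (gamma : D_object tau A) : action_data G A :=
  ActionData (fun y z g => prange (@Ext_pmap G x tau A gamma y z g))
             (fun y z g => pfun (@Ext_pmap G x tau A gamma y z g)).

(* Main.v *)
Require Import Defs.
From HB Require Import structures.
From mathcomp Require Import all_boot all_order all_algebra.
From mathcomp Require Import boolp classical_sets functions.

Set Implicit Arguments.
Unset Strict Implicit.
Unset Printing Implicit Defensive.
Import GRing.Theory.
Local Open Scope classical_set_scope.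
Local Open Scope ring_scope.

(* In both directions the point is that all ideals [A_g] of the partial action
   must be unital. If [(B, beta)] is a globalization and the [A_x] are unital,
   then [A_g = A_{t(g)} \cap beta_g(A_{s(g)})] is an intersection of two unital
   ideals of [B_{t(g)}], hence unital. Conversely, if all [A_g] are unital,
   [alpha_g] extends to [P_g a = alpha_g(a 1_{g^{-1}})] on [A_{s(g)}], and
   [A_y] embeds into the ring of functions on the morphisms into a base point
   [x], a morphism [m : y -> x] giving [psi_m a : h |-> P_{h^{-1} m} a]. The
   subring spanned by these functions, with [G(x)] acting by translation, is a
   globalization because [P_k P_l a = P_{kl}(a) 1_k]. For [Ext gamma] the ideals
   [A_g] are images of intersections of the ideals [I_{tau_y^{-1}}] and [I_h],
   with [h] in [G(x)], and conversely [I_h] and [I_{tau_y}] occur among the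
   [A_g]. *)

(** * Ideals and their units *)

Section RngTheory.
Variable A : rngType.
Implicit Types (a b : A) (J K R : set A).

Lemma rmul0 a : a ** 0 = 0.
Proof. by apply: (addrI (a ** 0)); rewrite -rmulDr !addr0. Qed.

Lemma r0mul a : 0 ** a = 0.
Proof. by apply: (addrI (0 ** a)); rewrite -rmulDl !addr0. Qed.

Lemma idealN J R a : ideal_of J R -> J a -> J (- a).
Proof. by case=> _ J0 JB _ Ja; rewrite -sub0r; apply: JB. Qed.

Lemma idealD J R a b : ideal_of J R -> J a -> J b -> J (a + b).
Proof.
move=> iJ Ja Jb; rewrite -[b]opprK; have Jn := idealN iJ Jb.
by case: iJ => _ _ JB _; apply: JB.
Qed.

Lemma idealMl J R r a : ideal_of J R -> R r -> J a -> J (r ** a).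
Proof. by case=> _ _ _ JM Rr /(JM r)-/(_ Rr)[]. Qed.

Lemma idealMr J R r a : ideal_of J R -> R r -> J a -> J (a ** r).
Proof. by case=> _ _ _ JM Rr /(JM r)-/(_ Rr)[]. Qed.

Lemma ideal_sub J R : ideal_of J R -> J `<=` R. Proof. by case. Qed.

Lemma ideal0 J R : ideal_of J R -> J 0. Proof. by case. Qed.

Lemma idealM J R a b : ideal_of J R -> J a -> J b -> J (a ** b).
Proof. by move=> iJ Ja Jb; apply: (idealMl iJ) => //; apply: (ideal_sub iJ). Qed.

(* [0] if [J] is not unital *)
Definition unit_of J : A :=
  xget 0 [set e | J e /\ forall a, J a -> e ** a = a /\ a ** e = a].

Lemma unit_ofP J : unital J ->
  J (unit_of J) /\ forall a, J a -> unit_of J ** a = a /\ a ** unit_of J = a.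
Proof.
case=> e Je eP; rewrite /unit_of; case: xgetP => [? _ //|/(_ e) []].
by split.
Qed.

Lemma unit_of_in J : unital J -> J (unit_of J).
Proof. by case/unit_ofP. Qed.

Lemma unit_ofl J a : unital J -> J a -> unit_of J ** a = a.
Proof. by case/unit_ofP=> _ uP /uP[]. Qed.

Lemma unit_ofr J a : unital J -> J a -> a ** unit_of J = a.
Proof. by case/unit_ofP=> _ uP /uP[]. Qed.

(** The product of the two units lies in both ideals, because each absorbs elements of [R], and it
    is the unit sought. *)
Lemma unitalI J K R : ideal_of J R -> ideal_of K R ->
  unital J -> unital K -> unital (J `&` K).
Proof.
move=> iJ iK [e Je eP] [f Kf fP]; exists (e ** f).
  split; first by apply: (idealMr iJ) => //; apply: (ideal_sub iK).
  by apply: (idealMl iK) => //; apply: (ideal_sub iJ).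
move=> a [Ja Ka]; have [ea ae] := eP _ Ja; have [fa af] := fP _ Ka.
by rewrite -rmulA fa ea rmulA ae af.
Qed.

Lemma unital_image (B : rngType) (J : set A) (f : A -> B) :
  ring_hom_on J f -> unital J -> unital (f @` J).
Proof.
move=> fM [e Je eP]; exists (f e); first by exists e.
move=> _ [a Ja <-]; have [ea ae] := eP _ Ja.
by rewrite -(fM _ _ Je Ja).2 -(fM _ _ Ja Je).2 ea ae.
Qed.

End RngTheory.

(** * Rings of functions, and subrings turned into types *)

Section FunctionRng.
Variables (T : Type) (A : rngType).

Definition fun_rmul (f g : T -> A) : T -> A := fun t => f t ** g t.

Fact fun_rmulA : associative fun_rmul.
Proof. by move=> f g h; apply/funext => t; apply: rmulA. Qed.

Fact fun_rmulDl : left_distributive fun_rmul +%R.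
Proof. by move=> f g h; apply/funext => t; apply: rmulDl. Qed.

Fact fun_rmulDr : right_distributive fun_rmul +%R.
Proof. by move=> f g h; apply/funext => t; apply: rmulDr. Qed.

HB.instance Definition _ :=
  Zmodule_isRng.Build (T -> A) fun_rmulA fun_rmulDl fun_rmulDr.

End FunctionRng.

(** A globalization requires a ring that is a type, whereas the one built below is a span inside a
    ring of functions. Through the embedding [j], identities in [B] can be checked on functions. *)
Lemma subrng_type (F : rngType) (S : set F) :
    S 0 -> (forall a b, S a -> S b -> S (a - b)) ->
    (forall a b, S a -> S b -> S (a ** b)) ->
  exists (B : rngType) (j : B -> F),
    [/\ injective j, forall b, S (j b), forall f, S f -> exists b, j b = f,
        {morph j : a b / a + b} & {morph j : a b / a ** b}].
Proof.
move=> S0 SB SM; pose T := {f : F | S f}.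
have SN a : S a -> S (- a) by move=> Sa; rewrite -sub0r; apply: SB.
have SD a b : S a -> S b -> S (a + b).
  by move=> Sa Sb; rewrite -[b]opprK; apply: SB => //; apply: SN.
pose z : T := exist _ 0 S0.
pose opp (a : T) : T := exist _ (- sval a) (SN _ (svalP a)).
pose add (a b : T) : T := exist _ (sval a + sval b) (SD _ _ (svalP a) (svalP b)).
pose mul (a b : T) : T := exist _ (sval a ** sval b) (SM _ _ (svalP a) (svalP b)).
have inj (a b : T) : sval a = sval b -> a = b.
  by case: a b => [a Sa] [b Sb] /= E; subst b; rewrite (Prop_irrelevance Sa Sb).
have addA : associative add by move=> a b c; apply: inj; apply: addrA.
have addC : commutative add by move=> a b; apply: inj; apply: addrC.
have add0 : left_id z add by move=> a; apply: inj; apply: add0r.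
have addN : left_inverse z opp add by move=> a; apply: inj; apply: addNr.
have mulA : associative mul by move=> a b c; apply: inj; apply: rmulA.
have mulDl : left_distributive mul add.
  by move=> a b c; apply: inj; apply: rmulDl.
have mulDr : right_distributive mul add.
  by move=> a b c; apply: inj; apply: rmulDr.
pose C : choiceType := HB.pack T (gen_eqMixin T) (gen_choiceMixin T).
pose Z : zmodType :=
  HB.pack T (Choice.on C) (@GRing.isZmodule.Build C z opp add addA addC add0 addN).
pose B : rngType :=
  HB.pack T (GRing.Zmodule.on Z) (@Zmodule_isRng.Build Z mul mulA mulDl mulDr).
exists B, (@sval F S); split => //.
- exact: svalP.
- by move=> f Sf; exists (exist _ f Sf).
Qed.

(** * Cancellation laws in a groupoid *)

Section GroupoidTheory.
Variable G : groupoid.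
Implicit Types x y z w : G.

Lemma compKm x y z (g : mor y z) (h : mor x y) : compm (minv g) (compm g h) = h.
Proof. by rewrite compmA compVm comp1m. Qed.

Lemma compVKm x y z (g : mor z y) (h : mor x y) : compm g (compm (minv g) h) = h.
Proof. by rewrite compmA compmV comp1m. Qed.

Lemma compmK x y z (g : mor y z) (h : mor x y) : compm (compm g h) (minv h) = g.
Proof. by rewrite -compmA compmV compm1. Qed.

Lemma compmVK x y z (g : mor y z) (h : mor y x) : compm (compm g (minv h)) h = g.
Proof. by rewrite -compmA compVm compm1. Qed.

Lemma minv_unique x y (g : mor x y) (h : mor y x) :
  compm h g = idmor x -> h = minv g.
Proof. by move=> E; rewrite -[h](compmK _ g) E comp1m. Qed.

Lemma minvK x y (g : mor x y) : minv (minv g) = g.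
Proof. by apply/esym/minv_unique; rewrite compmV. Qed.

Lemma minv1 x : minv (idmor x) = idmor x.
Proof. by apply/esym/minv_unique; rewrite comp1m. Qed.

Lemma minvM x y z (g : mor y z) (h : mor x y) :
  minv (compm g h) = compm (minv h) (minv g).
Proof. by apply/esym/minv_unique; rewrite -compmA compKm compVm. Qed.

End GroupoidTheory.

(** * Partial actions through the graphs of their maps *)

(** Seen as relations, partial bijections can be inverted and composed without keeping track of
    domains. *)
Definition act_graph (G : groupoid) (A : Type) (alpha : action_data G A)
    (x y : G) (g : mor x y) (a b : A) : Prop :=
  aset alpha (minv g) a /\ amap alpha g a = b.

Section PartialActionTheory.
Variables (G : groupoid) (A : rngType) (R : set A) (alpha : action_data G A).
Hypothesis pa : partial_action R alpha.
Implicit Types x y z w : G.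
Local Notation D := (@aset G A alpha _ _).
Local Notation act := (@amap G A alpha _ _).
Local Notation graph := (@act_graph G A alpha _ _).

Lemma act_in x y (g : mor x y) a : D (minv g) a -> D g (act g a).
Proof. by move=> Da; case: (pa_iso pa g) => -[gD _ _] _; apply: gD. Qed.

Lemma act_ideal_src x y (g : mor x y) : ideal_of (D (minv g)) (oset alpha x).
Proof. exact: pa_ideal pa _ _ _. Qed.

Lemma actD x y (g : mor x y) a b : D (minv g) a -> D (minv g) b ->
  act g (a + b) = act g a + act g b.
Proof. by move=> Da Db; case: (pa_iso pa g) => _ /(_ _ _ Da Db)[]. Qed.

Lemma actM x y (g : mor x y) a b : D (minv g) a -> D (minv g) b ->
  act g (a ** b) = act g a ** act g b.
Proof. by move=> Da Db; case: (pa_iso pa g) => _ /(_ _ _ Da Db)[]. Qed.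

Lemma graph_cod x y (g : mor x y) a b : graph g a b -> D g b.
Proof. by case=> Da <-; apply: act_in. Qed.

(** The middle element [b] lies in both [D (minv g)] and [D h], so (P3) gives the domain and (P4)
    the value. *)
Lemma graph_comp x y z (g : mor y z) (h : mor x y) a b c :
  graph h a b -> graph g b c -> graph (compm g h) a c.
Proof.
move=> [Da hab] [Db gbc].
have Dgha : comp_dom alpha g h a.
  by split=> //=; rewrite hab; split=> //; rewrite -hab; apply: act_in.
split; first exact: pa_dom pa _ _ _ _ _ _ Dgha.
by rewrite -(pa_comp pa Dgha) hab.
Qed.

Lemma graph_id x a : oset alpha x a -> graph (idmor x) a a.
Proof. by move=> Da; split; rewrite ?minv1 ?(pa_id pa). Qed.

Lemma graph_idE x a b : graph (idmor x) a b -> a = b.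
Proof. by case; rewrite minv1 => Da <-; rewrite (pa_id pa). Qed.

Lemma graph_fun x y (g : mor x y) a b b' : graph g a b -> graph g a b' -> b = b'.
Proof. by case=> _ <- [_ <-]. Qed.

(** Following [g] by [minv g] gives a pair in the graph of an identity, whose entries agree by
    (P2). *)
Lemma graphV x y (g : mor x y) a b : graph g a b -> graph (minv g) b a.
Proof.
move=> gab; have Db := graph_cod gab.
have gbc : graph (minv g) b (act (minv g) b) by split; rewrite ?minvK.
have := graph_comp gab gbc; rewrite compVm => /graph_idE E.
by rewrite -E in gbc.
Qed.

Lemma graph_ex x y (g : mor x y) b : D g b -> exists a, graph g a b.
Proof.
move=> Db; exists (act (minv g) b); rewrite -[X in graph X]minvK.
by apply: graphV; split; rewrite ?minvK.
Qed.

Lemma graph_act x y (g : mor x y) a : D (minv g) a -> graph g a (act g a).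
Proof. by []. Qed.

Lemma graphD x y (g : mor x y) a b a' b' :
  graph g a b -> graph g a' b' -> graph g (a + a') (b + b').
Proof.
move=> [Da <-] [Da' <-]; split; last by rewrite actD.
exact: idealD (act_ideal_src g) Da Da'.
Qed.

Lemma graphM x y (g : mor x y) a b a' b' :
  graph g a b -> graph g a' b' -> graph g (a ** a') (b ** b').
Proof.
move=> [Da <-] [Da' <-]; split; last by rewrite actM.
exact: idealM (act_ideal_src g) Da Da'.
Qed.

End PartialActionTheory.

(* A family of partial maps closed under inverses and composites is a partial
   action: this is what (P1)-(P4) say about the graphs of the [alpha_g]. *)
Lemma partial_action_graph (G : groupoid) (A : rngType) (R : set A)
    (alpha : action_data G A)
    (rho : forall x y : G, mor x y -> A -> A -> Prop) :
    (forall x, ideal_of (oset alpha x) R) ->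
    (forall (x y : G) (g : mor x y), ideal_of (aset alpha g) (oset alpha y)) ->
    (forall (x y : G) (g : mor x y) b,
       aset alpha g b <-> exists a, rho _ _ g a b) ->
    (forall (x y : G) (g : mor x y) a b, rho _ _ g a b -> amap alpha g a = b) ->
    (forall x a, oset alpha x a -> rho _ _ (idmor x) a a) ->
    (forall (x y : G) (g : mor x y) a b, rho _ _ g a b -> rho _ _ (minv g) b a) ->
    (forall (x y z : G) (g : mor y z) (h : mor x y) a b c,
       rho _ _ h a b -> rho _ _ g b c -> rho _ _ (compm g h) a c) ->
    (forall (x y : G) (g : mor x y) a b a' b', rho _ _ g a b -> rho _ _ g a' b' ->
       rho _ _ g (a + a') (b + b') /\ rho _ _ g (a ** a') (b ** b')) ->
  partial_action R alpha.
Proof.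
move=> iR iD codP funP idP invP compP homP.
have domP x y (g : mor x y) a :
    aset alpha (minv g) a -> rho _ _ g a (amap alpha g a).
  move=> /codP[b /invP]; rewrite minvK => gab.
  by rewrite (funP _ _ _ _ _ gab).
have domI x y (g : mor x y) a b : rho _ _ g a b -> aset alpha (minv g) a.
  by move=> /invP gba; apply/codP; exists b.
split=> //.
- move=> x y g; split; first split.
  + by move=> a /domP ga; apply/codP; exists a.
  + move=> a b /set_mem/domP ga /set_mem/domP gb E.
    by move: ga gb; rewrite E => /invP/funP <- /invP/funP.
  + move=> b /codP[a gab]; exists a; first exact: domI gab.
    exact: funP gab.
  + move=> a b /domP ga /domP gb; have [/funP ? /funP ?] := homP _ _ _ _ _ _ _ ga gb.
    by split.
- by move=> x a /idP/funP.
- move=> x y z g h a [/domP ha [/= /domP gb _]].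
  exact: domI (compP _ _ _ _ _ _ _ _ ha gb).
- move=> x y z g h a [/domP ha [/= /domP gb _]].
  by rewrite (funP _ _ _ _ _ (compP _ _ _ _ _ _ _ _ ha gb)).
Qed.

(** * Induction and closure properties of [sum_of] *)

Lemma sum_of_ind (B : rngType) (X P : set B) :
    P 0 -> (forall a b, P a -> P b -> P (a + b)) -> X `<=` P ->
  sum_of X `<=` P.
Proof.
move=> P0 PD XP b [r rX ->]; elim: r rX => [|c r IH] rX; first by rewrite big_nil.
rewrite big_cons; apply: PD; first by apply: XP; apply: rX; rewrite mem_head.
by apply: IH => d dr; apply: rX; rewrite in_cons dr orbT.
Qed.

Lemma sum_of_incl (B : rngType) (X : set B) : X `<=` sum_of X.
Proof.
move=> b Xb; exists [:: b]; last by rewrite big_seq1.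
by move=> c; rewrite inE => /eqP ->.
Qed.

Lemma sum_of0 (B : rngType) (X : set B) : sum_of X 0.
Proof. by exists [::]; rewrite ?big_nil. Qed.

Lemma sum_ofD (B : rngType) (X : set B) a b :
  sum_of X a -> sum_of X b -> sum_of X (a + b).
Proof.
move=> [r rX ->] [s sX ->]; exists (r ++ s); last by rewrite big_cat.
by move=> c; rewrite mem_cat => /orP[/rX|/sX].
Qed.

Lemma sum_ofB (B : rngType) (X : set B) a b : (forall c, X c -> X (- c)) ->
  sum_of X a -> sum_of X b -> sum_of X (a - b).
Proof.
move=> XN Xa Xb; apply: sum_ofD => //; move: b Xb; apply: sum_of_ind.
- by rewrite /= oppr0; apply: sum_of0.
- by move=> b c /= Xb Xc; rewrite opprD; apply: sum_ofD.
- by move=> c /XN; apply: sum_of_incl.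
Qed.

Lemma sum_ofM (B : rngType) (X : set B) a b :
    (forall c d, X c -> X d -> X (c ** d)) ->
  sum_of X a -> sum_of X b -> sum_of X (a ** b).
Proof.
move=> XM Xa Xb; move: a Xa; apply: sum_of_ind => /=.
- by rewrite r0mul; apply: sum_of0.
- by move=> a c Xab Xcb; rewrite rmulDl; apply: sum_ofD.
move=> a Xa; move: b Xb; apply: sum_of_ind => /=.
- by rewrite rmul0; apply: sum_of0.
- by move=> b c Xb Xc; rewrite rmulDr; apply: sum_ofD.
- by move=> b Xb; apply/sum_of_incl/XM.
Qed.

(** * Globalization of a partial action all of whose ideals are unital *)

Section UnitalGlobalization.
Variables (G : groupoid) (A : rngType) (R : set A) (alpha : action_data G A).
Hypothesis pa : partial_action R alpha.
Hypothesis alpha_unital : forall (x y : G) (g : mor x y), unital (aset alpha g).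
Implicit Types x y z w : G.
Local Notation D := (@aset G A alpha _ _).
Local Notation Do := (oset alpha).
Local Notation act := (@amap G A alpha _ _).
Local Notation graph := (@act_graph G A alpha _ _).
Local Notation u g := (unit_of (D g)).

Let uin x y (g : mor x y) : D g (u g). Proof. exact: unit_of_in. Qed.
Let ul x y (g : mor x y) a : D g a -> u g ** a = a. Proof. exact: unit_ofl. Qed.
Let ur x y (g : mor x y) a : D g a -> a ** u g = a. Proof. exact: unit_ofr. Qed.
Let Dsub x y (g : mor x y) a : D g a -> Do y a.
Proof. exact: (ideal_sub (pa_ideal pa g)). Qed.
Let Dl x y (g : mor x y) r a : Do y r -> D g a -> D g (r ** a).
Proof. exact: (idealMl (pa_ideal pa g)). Qed.
Let Dr x y (g : mor x y) r a : Do y r -> D g a -> D g (a ** r).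
Proof. exact: (idealMr (pa_ideal pa g)). Qed.

(* [alpha_k] extended to the whole of [A_{s(k)}], through the projection onto
   its ideal direct factor [A_{k^{-1}}]. *)
Definition cut y w (k : mor y w) (a : A) : A := act k (a ** u (minv k)).

Lemma cut_in y w (k : mor y w) a : Do y a -> D k (cut k a).
Proof. by move=> Da; apply: (act_in pa); apply: Dl. Qed.

Lemma cutE y w (k : mor y w) a : D (minv k) a -> cut k a = act k a.
Proof. by move=> Da; rewrite /cut ur. Qed.

Lemma cut_id y a : Do y a -> cut (idmor y) a = a.
Proof. by move=> Da; rewrite cutE ?minv1 // (pa_id pa). Qed.

Lemma cutD y w (k : mor y w) a b : Do y a -> Do y b ->
  cut k (a + b) = cut k a + cut k b.
Proof. by move=> Da Db; rewrite /cut rmulDl (actD pa) //; apply: Dl. Qed.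

(** The factor [b] absorbs the unit hidden in [cut k a], so beside [act k b] the truncation is
    invisible. *)
Lemma cut_mul_act y w (k : mor y w) a b : Do y a -> D (minv k) b ->
  cut k a ** act k b = act k (a ** b).
Proof. by move=> Da Db; rewrite /cut -(actM pa) -?rmulA ?ul //; apply: Dl. Qed.

Lemma cutM y w (k : mor y w) a b : Do y a -> Do y b ->
  cut k (a ** b) = cut k a ** cut k b.
Proof. by move=> Da Db; rewrite {3}/cut cut_mul_act ?rmulA //; apply: Dl. Qed.

Lemma act_unit y w (k : mor y w) : act k (u (minv k)) = u k.
Proof.
have [c [Dc E]] := graph_ex pa (uin k).
rewrite -(ur (act_in pa (uin (minv k)))).
by rewrite -E -(actM pa) // ul.
Qed.

(* Both sides lie in the unital ideal [D_{kl} \cap D_k], on which they have the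
   same products: the elements of that ideal are images under
   [alpha_k alpha_l = alpha_{kl}]. *)
Lemma cut_comp y w v (k : mor w v) (l : mor y w) a : Do y a ->
  cut k (cut l a) = cut (compm k l) a ** u k.
Proof.
move=> Da; have Dp := cut_in l Da; have Dop := Dsub Dp.
set p := cut l a in Dp Dop *; set kl := compm k l.
have Dq := cut_in k Dop; have Dr' := cut_in kl Da.
have same c : D kl c -> D k c -> cut k p ** c = cut kl a ** c.
  move=> /(graph_ex pa)[c' klc] /(graph_ex pa)[c'' kc].
  (* Going along [kl] and back along [k] amounts to [l], which therefore relates the two preimages
     of [c]. *)
  have lc : graph l c' c''.
    by have := graph_comp pa klc (graphV pa kc); rewrite compKm.
  case: (klc) => Dc' <-; case: (lc) => Dlc' lE; case: (kc) => Dc'' kE.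
  rewrite cut_mul_act //; case: klc => _ ->; rewrite -kE cut_mul_act //.
  rewrite -lE cut_mul_act //.
  have l1 : graph l (a ** c') (act l (a ** c')) by split=> //; apply: Dl.
  apply: (@graph_fun _ _ _ _ _ kl (a ** c')); last by split=> //; apply: Dl.
  apply: (graph_comp pa l1); split=> //.
  by rewrite -cut_mul_act // lE; apply: Dl.
(* The [k]-preimage [p ** u (minv k)] of [cut k p] still lies in the ideal [D l], so it has an
   [l]-preimage. *)
have Dqkl : D kl (cut k p).
  have Dc : D (minv k) (p ** u (minv k)) by apply: Dl.
  have [d ld] : exists d, graph l d (p ** u (minv k)).
    by apply: (graph_ex pa); apply: Dr => //; apply: Dsub (uin _).
  exact: (graph_cod pa (graph_comp pa ld (graph_act Dc))).
(* The comparison is made against [u kl ** u k], which belongs to both ideals. *)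
rewrite -[LHS](ur Dq) -{1}(ur Dqkl) -rmulA same.
- by rewrite rmulA (ur Dr').
- by apply: Dr => //; apply: Dsub (uin _).
- by apply: Dl => //; apply: Dsub (uin _).
Qed.

Variable x : G.

(** A single index type for all sources [w] puts the translates of the different [A_y] into one ring
    of functions. *)
Definition mor_to : Type := {w : G & mor w x}.

(* [psi m a] is the translate by [m] of the image of [a] in the globalization. *)
Definition psi y (m : mor y x) (a : A) : mor_to -> A :=
  fun t => cut (compm (minv (projT2 t)) m) a.

(** Inverting [k] makes this a left action of the group at [x]. *)
Definition shift (k : mor x x) (f : mor_to -> A) : mor_to -> A :=
  fun t => f (existT _ (projT1 t) (compm (minv k) (projT2 t))).

Lemma shift_psi y (m : mor y x) k a : shift k (psi m a) = psi (compm k m) a.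
Proof. by apply/funext => t; rewrite /shift /psi /= minvM minvK compmA. Qed.

Lemma shift_comp k l f : shift k (shift l f) = shift (compm k l) f.
Proof. by apply/funext => t; rewrite /shift /= minvM compmA. Qed.

Lemma shift_id f : shift (idmor x) f = f.
Proof. by apply/funext => -[w t]; rewrite /shift /= minv1 comp1m. Qed.

Lemma psiD y (m : mor y x) a b : Do y a -> Do y b ->
  psi m (a + b) = psi m a + psi m b.
Proof. by move=> Da Db; apply/funext => t; rewrite /psi cutD. Qed.

Lemma psi0 y (m : mor y x) : psi m 0 = 0.
Proof.
have D0 : Do y 0 by exact: (ideal0 (pa_object pa y)).
by apply: (addrI (psi m 0)); rewrite -psiD // !addr0.
Qed.

Lemma psiN y (m : mor y x) a : Do y a -> psi m (- a) = - psi m a.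
Proof.
move=> Da; apply/eqP; rewrite -addr_eq0 -psiD //; last exact: (idealN (pa_object pa y)).
by rewrite addNr psi0.
Qed.

Lemma psiM y (m : mor y x) a b : Do y a -> Do y b ->
  psi m (a ** b) = psi m a ** psi m b.
Proof. by move=> Da Db; apply/funext => t; rewrite /psi cutM. Qed.

(** At the index [m] the morphism that acts is an identity. This evaluation gives the injectivity of
    [psi m] on [A_y]. *)
Lemma psi_eval y (m : mor y x) a : Do y a -> psi m a (existT _ y m) = a.
Proof. by move=> Da; rewrite /psi /= compVm cut_id. Qed.

(** At an index [h], with [k = h^{-1} m], [cut_comp] leaves a stray factor [u k]; it is absorbed
    because [cut k a] puts the product in [D k]. Hence the image of [psi m] absorbs the generators
    of the span, as (G1) demands. *)
Lemma psi_mull y z (m : mor y x) (n : mor z x) a b : Do y a -> Do z b ->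
  psi m a ** psi n b = psi m (a ** cut (compm (minv m) n) b).
Proof.
move=> Da Db; apply/funext => -[w h]; rewrite /psi /=.
set k := compm (minv h) m.
have Dmn := Dsub (cut_in (compm (minv m) n) Db).
rewrite cutM // cut_comp // /k -compmA compVKm.
rewrite [LHS]/rmul /= /fun_rmul /= rmulA ur //.
apply: Dr (cut_in _ Da); exact: Dsub (cut_in _ Db).
Qed.

Lemma psi_mulr y z (m : mor y x) (n : mor z x) a b : Do y a -> Do z b ->
  psi m a ** psi n b = psi n (cut (compm (minv n) m) a ** b).
Proof.
move=> Da Db; apply/funext => -[w h]; rewrite /psi /=.
set k := compm (minv h) n.
have Dmn := Dsub (cut_in (compm (minv n) m) Da).
rewrite cutM // cut_comp // /k -compmA compVKm.
by rewrite -rmulA ul //; apply: cut_in.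
Qed.

(** Both sides equal the product [psi m (u g) ** psi (compm m g) a], written at [m] by [psi_mull]
    and at [compm m g] by [psi_mulr]. *)
Lemma psi_move y z (g : mor y z) (m : mor z x) a : D (minv g) a ->
  psi (compm m g) a = psi m (act g a).
Proof.
move=> Da; have Du := Dsub (uin g); have Dga := act_in pa Da.
have Doa := Dsub Da.
have := psi_mull m (compm m g) Du Doa; rewrite compKm cutE // ul // => <-.
rewrite psi_mulr // minvM compmVK cutE ?minvK //.
by have := act_unit (minv g); rewrite minvK => ->; rewrite ul.
Qed.

Variable t : forall y, mor y x.

(** The functor from [G] to the group at [x] determined by the morphisms [t]. Since all [B_y] will
    be equal, [g] can act by the translation [shift (tv g)]. *)
Let tv y z (g : mor y z) : mor x x := compm (t z) (compm g (minv (t y))).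

Let tvM y z w (g : mor z w) (h : mor y z) : tv (compm g h) = compm (tv g) (tv h).
Proof. by rewrite /tv -!compmA compKm. Qed.

Let tv1 y : tv (idmor y) = idmor x.
Proof. by rewrite /tv comp1m compmV. Qed.

Let tv_t y z (g : mor y z) : compm (tv g) (t y) = compm (t z) g.
Proof. by rewrite /tv -!compmA compVm compm1. Qed.

Let gens : set (mor_to -> A) :=
  [set f | exists y (m : mor y x) a, Do y a /\ f = psi m a].

Let span := sum_of gens.

Let span_psi y (m : mor y x) a : Do y a -> span (psi m a).
Proof. by move=> Da; apply: sum_of_incl; exists y, m, a. Qed.

Let span_shift k f : span f -> span (shift k f).
Proof.
move: f; apply: sum_of_ind; first exact: sum_of0.
- by move=> f f' Sf Sf'; apply: (sum_ofD Sf Sf').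
- by move=> _ [y [m [a [Da ->]]]] /=; rewrite shift_psi; apply: span_psi.
Qed.

(* All the rings [B_y] are taken to be the same ring [B], spanned by the
   [psi m a]; an isomorphism [B_y -> B] is given by the chosen morphism [t y]. *)
Theorem unital_globalizable : globalizable alpha.
Proof.
have Dm0 z y (m : mor z x) (n : mor y x) a b : Do z a -> Do y b ->
    Do y (cut (compm (minv n) m) a ** b).
  move=> Da Db; apply: (idealM (pa_object pa y)) => //.
  exact: Dsub (cut_in _ Da).
have Dm1 z y (m : mor z x) (n : mor y x) a b : Do z a -> Do y b ->
    Do y (b ** cut (compm (minv n) m) a).
  move=> Da Db; apply: (idealM (pa_object pa y)) => //.
  exact: Dsub (cut_in _ Da).
have [|||B [j [j_inj jS jsurj jD jM]]] := @subrng_type (mor_to -> A) span.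
- exact: sum_of0.
- move=> f f'; apply: sum_ofB => _ [y [m [a [Da ->]]]].
  exists y, m, (- a); rewrite psiN //; split=> //.
  exact: (idealN (pa_object pa y)).
- move=> f f'; apply: sum_ofM => _ _ [y [m [a [Da ->]]]] [z [n [b [Db ->]]]].
  by rewrite psi_mulr //; exists z, n; eexists; split; last reflexivity; apply: Dm0.
(* [ji] is a chosen inverse of [j] on the span; its values elsewhere are immaterial. *)
have [ji jiK] : exists ji, forall f, span f -> j (ji f) = f.
  suff /choice[ji jiP] : forall f, exists b, span f -> j b = f by exists ji.
  move=> f.
  have [/jsurj[b]|nS] := pselect (span f); first by exists b.
  by exists 0.
have j0 : j 0 = 0 by apply: (addrI (j 0)); rewrite -jD !addr0.
have jN b : j (- b) = - j b by apply/eqP; rewrite -addr_eq0 -jD addNr j0.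
pose bact y z (g : mor y z) b := ji (shift (tv g) (j b)).
pose beta := ActionData (fun y z (g : mor y z) => [set: B]) bact.
pose iota y a := ji (psi (t y) a).
have jb y z (g : mor y z) b : j (bact _ _ g b) = shift (tv g) (j b).
  by rewrite jiK //; apply: span_shift.
have jio y a : Do y a -> j (iota y a) = psi (t y) a.
  by move=> Da; rewrite jiK //; apply: span_psi.
have jbio y z (g : mor y z) a : Do y a ->
    j (bact _ _ g (iota y a)) = psi (compm (t z) g) a.
  by move=> Da; rewrite jb jio // shift_psi tv_t.
have bactM y z w (g : mor z w) (h : mor y z) b :
    bact _ _ g (bact _ _ h b) = bact _ _ (compm g h) b.
  by apply: j_inj; rewrite !jb shift_comp tvM.
have bact1 y b : bact _ _ (idmor y) b = b.
  by apply: j_inj; rewrite jb tv1 shift_id.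
have bactK y z (g : mor y z) b : bact _ _ g (bact _ _ (minv g) b) = b.
  by rewrite bactM compmV bact1.
have bactVK y z (g : mor y z) b : bact _ _ (minv g) (bact _ _ g b) = b.
  by rewrite bactM compVm bact1.
have iotaD y a b : Do y a -> Do y b -> iota y (a + b) = iota y a + iota y b.
  move=> Da Db; apply: j_inj; rewrite jD !jio ?psiD //.
  exact: (idealD (pa_object pa y)).
have iotaM y a b : Do y a -> Do y b -> iota y (a ** b) = iota y a ** iota y b.
  move=> Da Db; apply: j_inj; rewrite jM !jio ?psiM //.
  exact: (idealM (pa_object pa y)).
exists B, beta, iota; split.
- split; last first.
    move=> y z w g h; split=> /=; last by move=> b _; apply: bactM.
    by apply/seteqP; split=> // b _; split=> //; split=> //; exists b.
  split=> //=.
  move=> y z g; split; first split.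
  + by [].
  + by move=> a b _ _ /(congr1 (bact _ _ (minv g))); rewrite !bactVK.
  + by move=> b _; exists (bact _ _ (minv g) b).
  + move=> a b _ _.
    by split; apply: j_inj; rewrite ?jD ?jM !jb ?jD ?jM.
- move=> y; split; first split.
  + by move=> a Da; exists a.
  + move=> a b /set_mem Da /set_mem Db /(congr1 j); rewrite !jio // => E.
    by rewrite -(psi_eval (t y) Da) E psi_eval.
  + by [].
  + by move=> a b Da Db; rewrite iotaD ?iotaM.
- move=> y; have iD := pa_object pa y; split.
  + by [].
  + exists 0; first exact: ideal0 iD.
    by apply: j_inj; rewrite jio ?psi0 ?j0 //; apply: ideal0 iD.
  + move=> _ _ [a Da <-] [b Db <-]; exists (a - b); first by case: iD => _ _ + _; apply.
    apply: j_inj; rewrite jD jN !jio -?psiN -?psiD //; first exact: (idealN iD).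
    by case: iD => _ _ + _; apply.
  + move=> r _ _ [a Da <-].
    (* The image of [A_y] is viewed among functions, where [r] becomes a sum of generators;
       induction on that sum reduces absorption to [psi_mulr] and [psi_mull]. *)
    pose J := [set f | exists2 b, Do y b & f = psi (t y) b].
    have J0 : J 0 by exists 0; rewrite ?psi0 //; apply: ideal0 iD.
    have JD f f' : J f -> J f' -> J (f + f').
      move=> [b Db ->] [b' Db' ->]; exists (b + b'); rewrite ?psiD //.
      exact: (idealD iD).
    have JS f : J f -> forall s, j s = f -> (iota y @` oset alpha y) s.
      by move=> [b Db ->] s E; exists b => //; apply: j_inj; rewrite jio.
    split.
    * apply: (JS (j r ** psi (t y) a)); last by rewrite jM jio.
      move: (j r) (jS r); apply: sum_of_ind => /=; first by rewrite r0mul.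
        by move=> f f' Jf Jf'; rewrite rmulDl; apply: JD.
      move=> _ [z [m [b [Db ->]]]] /=; rewrite psi_mulr //.
      by eexists; last reflexivity; apply: Dm0.
    * apply: (JS (psi (t y) a ** j r)); last by rewrite jM jio.
      move: (j r) (jS r); apply: sum_of_ind => /=; first by rewrite rmul0.
        by move=> f f' Jf Jf'; rewrite rmulDr; apply: JD.
      move=> _ [z [m [b [Db ->]]]] /=; rewrite psi_mull //.
      by eexists; last reflexivity; apply: Dm1.
- move=> y z g; apply/seteqP; split.
  + move=> _ [a Da <-]; split; first by exists a => //; apply: Dsub Da.
    have [a' [Da' E]] := graph_ex pa Da.
    exists (iota y a'); first by exists a' => //; apply: Dsub Da'.
    apply: j_inj; rewrite jbio; last exact: Dsub Da'.
    by rewrite psi_move // E jio //; apply: Dsub Da.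
  (* Evaluated at the index [t z], the common element gives [a] on one side and [cut g b], an
     element of [A_g], on the other. *)
  + move=> _ [[a Da <-] [_ [b Db <-] /= /(congr1 j)]]; rewrite jbio // jio // => E.
    exists a => //; rewrite -(psi_eval (t z) Da) -E /psi /= compKm.
    exact: cut_in.
- move=> y z g a Da; apply: j_inj; rewrite /= jbio; last exact: Dsub Da.
  by rewrite psi_move // jio //; apply: Dsub (act_in pa Da).
- move=> y z g; apply/seteqP; split=> // b _ /=.
  have [r rG jbE] := jS b.
  exists [seq ji c | c <- r].
    move=> _ /mapP[f /rG[w [m [a [Da ->]]]] ->].
    (* Followed by [t z] this morphism gives back [m], so it carries [iota w a] to the element of
       [B] representing [psi m a]. *)
    exists w, (compm (minv (t z)) m), (iota w a); first by exists a.
    by apply: j_inj; rewrite /= jbio // compVKm jiK //; apply: span_psi.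
  apply: j_inj; rewrite jbE big_map.
  elim: r rG {jbE} => [|c r IH] rG; first by rewrite !big_nil j0.
  rewrite !big_cons jD jiK -?IH //.
    by move=> d dr; apply: rG; rewrite in_cons dr orbT.
  by apply/sum_of_incl/rG; rewrite mem_head.
Qed.

End UnitalGlobalization.

(** * Transport of ideals and units, and the units forced by a globalization *)

Lemma ideal_refl (A : rngType) (J R : set A) : ideal_of J R -> ideal_of J J.
Proof.
move=> iJ; have iB := iJ; case: iB => _ J0 JB _; split=> // r a Jr Ja.
by split; apply: (idealM iJ).
Qed.

Lemma ideal_capl (A : rngType) (J K R : set A) :
  ideal_of J R -> ideal_of K R -> ideal_of (J `&` K) K.
Proof.
move=> iJ iK; split.
- by move=> a [].
- split; [exact: ideal0 iJ | exact: ideal0 iK].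
- move=> a b [Ja Ka] [Jb Kb]; split.
    by case: iJ => _ _ JB _; apply: JB.
  by case: iK => _ _ KB _; apply: KB.
- move=> r a Kr [Ja Ka]; have Rr := ideal_sub iK Kr.
  split; split.
  + exact: idealMl iJ _ _.
  + exact: idealM iK _ _.
  + exact: idealMr iJ _ _.
  + exact: idealM iK _ _.
Qed.

(** An ideal of an ideal need not be an ideal; a unit repairs this, as [r ** a = (r ** e) ** a] with
    [r ** e] in [J]. *)
Lemma unital_ideal_trans (A : rngType) (K J R : set A) :
  unital K -> ideal_of K J -> ideal_of J R -> ideal_of K R.
Proof.
move=> [e Ke eP] iK iJ; have Je := ideal_sub iK Ke; split.
- by move=> a /(ideal_sub iK)/(ideal_sub iJ).
- exact: ideal0 iK.
- by case: iK.
- move=> r a Rr Ka; have [ea ae] := eP _ Ka; split.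
    by rewrite -ea rmulA; apply: (idealMl iK) => //; apply: (idealMl iJ).
  by rewrite -ae -rmulA; apply: (idealMr iK) => //; apply: (idealMr iJ).
Qed.

Lemma hom_on_sub (A B : rngType) (X Y : set A) (f : A -> B) :
  X `<=` Y -> ring_hom_on Y f -> ring_hom_on X f.
Proof. by move=> XY fM a b /XY Ya /XY Yb; apply: fM. Qed.

Lemma hom_onB (A B : rngType) (X R : set A) (f : A -> B) a b :
  ideal_of X R -> ring_hom_on X f -> X a -> X b -> f (a - b) = f a - f b.
Proof.
move=> iX fM Xa Xb; have XN := idealN iX Xb.
have X0 := ideal0 iX.
have f0 : f 0 = 0.
  by apply: (addrI (f 0)); rewrite -(fM _ _ X0 X0).1 !addr0.
rewrite (fM _ _ Xa XN).1; congr (_ + _).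
by apply/eqP; rewrite -addr_eq0 -(fM _ _ XN Xb).1 addNr f0.
Qed.

Lemma ideal_image (A B : rngType) (X R J : set A) (Y : set B) (f : A -> B) :
  ideal_of X R -> ring_iso X Y f -> ideal_of J X -> ideal_of (f @` J) Y.
Proof.
move=> iX [[fXY fI fS] fM] iJ; have JX := ideal_sub iJ; split.
- by move=> _ [a /JX Xa <-]; apply: fXY.
- exists 0; first exact: ideal0 iJ.
  have X0 := ideal0 iX.
  by apply: (addrI (f 0)); rewrite -(fM _ _ X0 X0).1 !addr0.
- move=> _ _ [a Ja <-] [b Jb <-]; exists (a - b); first by case: iJ => _ _ + _; apply.
  by apply: (hom_onB iX fM); apply: JX.
- move=> r _ /fS[s Xs <-] [a Ja <-]; have Xa := JX _ Ja; split.
    by exists (s ** a); [exact: idealMl iJ _ _ | rewrite (fM _ _ Xs Xa).2].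
  by exists (a ** s); [exact: idealMr iJ _ _ | rewrite (fM _ _ Xa Xs).2].
Qed.

Lemma unital_preimage (A B : rngType) (X J R : set A) (f : A -> B) :
    ideal_of J R -> J `<=` X -> ring_hom_on X f -> set_inj X f ->
  unital (f @` J) -> unital J.
Proof.
move=> iJ JX fM fI [_ [e Je <-] eP]; exists e => // a Ja.
have [Xa Xe] := (JX _ Ja, JX _ Je).
have [ea ae] : f e ** f a = f a /\ f a ** f e = f a by apply: eP; exists a.
split; apply: fI; rewrite ?inE //.
- by apply/JX/(idealM iJ).
- by rewrite (fM _ _ Xe Xa).2.
- by apply/JX/(idealM iJ).
- by rewrite (fM _ _ Xa Xe).2.
Qed.

Lemma globalizable_unital (G : groupoid) (A : rngType) (R : set A)
    (alpha : action_data G A) :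
    partial_action R alpha -> globalizable alpha ->
    (forall x, unital (oset alpha x)) ->
  forall (x y : G) (g : mor x y), unital (aset alpha g).
Proof.
move=> pa [B [beta [iota gl]]] uo x y g.
have [pb _] := gl_global gl.
(* The sum in (G4) depends only on the target, so [B_g = B_{t(g)}] and [beta_g] maps [B_{s(g)}]
   isomorphically onto [B_{t(g)}]. *)
have betaE z w (h : mor z w) : aset beta h = oset beta w.
  by rewrite /oset !(gl_sum gl).
have [[_ iI _] iM] := gl_embed gl y.
have iy := pa_ideal pa g.
(* As [iota y] is injective on [A_y], the unit may be sought in [B], where (G2) describes [A_g]. *)
apply: (unital_preimage iy (ideal_sub iy) iM iI).
rewrite (gl_inter gl).
have iso := pa_iso pb g; rewrite !betaE in iso.
apply: unitalI (gl_ideal gl y) _ _ _.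
- exact: ideal_image (pa_object pb x) iso (gl_ideal gl x).
- exact: unital_image iM (uo y).
- apply: unital_image.
    by case: iso => _; apply: hom_on_sub; apply: ideal_sub (gl_ideal gl x).
  by have [_ jM] := gl_embed gl x; apply: unital_image jM (uo x).
Qed.

(** * The partial action [Ext gamma] and its ideals *)

Section Extension.
Variables (G : groupoid) (x : G) (tau : obj_transversal x) (A : rngType).
Variable gamma : D_object tau A.
Implicit Types y z w : G.
Local Notation I := (Iset gamma).
Local Notation T := (tdom gamma).
Local Notation tm := (tmap gamma).
Local Notation V := (vdata gamma).
Local Notation pv := (vdata_action gamma).
Local Notation gx g := (to_vertex tau g).

Let vgraph (h : mor x x) := @act_graph (vertex_group x) A V tt tt h.

Lemma is_identity_eq y z (g : mor y z) : is_identity g -> y = z.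
Proof. by case. Qed.

(** [is_identity] is indexed by two objects, so eliminating it at a loop goes through a transport
    along an equality of objects, made trivial by proof irrelevance. *)
Lemma is_identity_loop y (g : mor y y) : is_identity g -> g = idmor y.
Proof.
move=> ig; pose P z w (h : mor z w) := forall e : z = w,
  h = eq_rect z (mor z) (idmor z) w e.
have PI z : P z z (idmor z) by move=> e; rewrite (Prop_irrelevance e erefl).
exact: (@is_identity_ind G P PI y y g ig erefl).
Qed.

Lemma to_vertex_comp y z w (g : mor z w) (h : mor y z) :
  gx (compm g h) = compm (gx g) (gx h).
Proof. by rewrite /to_vertex -!compmA compVKm. Qed.

Lemma to_vertex_id y : gx (idmor y) = idmor x.
Proof. by rewrite /to_vertex comp1m compVm. Qed.

Lemma to_vertex_inv y z (g : mor y z) : gx (minv g) = minv (gx g).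
Proof. by rewrite /to_vertex !minvM minvK compmA. Qed.

Lemma to_vertex_loop (h : mor x x) : gx h = h.
Proof. by rewrite /to_vertex tr_base minv1 comp1m compm1. Qed.

Lemma to_vertex_tr y : gx (tau y) = idmor x.
Proof. by rewrite /to_vertex tr_base compm1 compVm. Qed.

(** The graph of the composite of [gamma_{tau_z}], [gamma_{g_x}] and the inverse of [gamma_{tau_y}],
    taken for identities as well; [c] and [d] are its intermediate points in [I_x]. *)
Definition cgraph y z (g : mor y z) (a b : A) : Prop :=
  exists c d, [/\ T y c, tm y c = a, vgraph (gx g) c d, T z d & tm z d = b].

(** At an identity the second alternative is contained in the first ([cgraph_identity]), so the
    disjunction never requires deciding whether a composite is an identity. *)
Definition ext_graph y z (g : mor y z) (a b : A) : Prop :=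
  [/\ is_identity g, a = b & I y a] \/ cgraph g a b.

Lemma tmap_inj y a b : T y a -> T y b -> tm y a = tm y b -> a = b.
Proof.
by move=> Ta Tb; case: (tmap_iso gamma y) => -[_ tI _] _; apply: tI; rewrite inE.
Qed.

Lemma tmap_in y a : T y a -> I y (tm y a).
Proof.
move=> Ta; apply: (ideal_sub (tcod_ideal gamma y)).
by case: (tmap_iso gamma y) => -[+ _ _] _; apply.
Qed.

(** Injectivity of [gamma_{tau_z}] identifies the two intermediate points over [b]; the rest is
    functoriality of [g_x]. *)
Lemma cgraph_comp y z w (g : mor z w) (h : mor y z) a b c :
  cgraph h a b -> cgraph g b c -> cgraph (compm g h) a c.
Proof.
move=> [p [q [Tp pa pq Tq qb]]] [q' [r [Tq' qb' qr Tr rc]]].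
have E : q = q' by apply: (@tmap_inj z) => //; rewrite qb qb'.
rewrite -{}E in qr; exists p, r; split=> //.
by rewrite to_vertex_comp; apply: (graph_comp pv pq qr).
Qed.

Lemma cgraphV y z (g : mor y z) a b : cgraph g a b -> cgraph (minv g) b a.
Proof.
move=> [p [q [Tp pa pq Tq qb]]]; exists q, p; split=> //.
by rewrite to_vertex_inv; apply: (graphV pv pq).
Qed.

Lemma cgraph_identity y z (g : mor y z) a b : is_identity g -> cgraph g a b ->
  a = b /\ I y a.
Proof.
case=> {y z g} y [p [q [Tp <- pq Tq <-]]]; split; last exact: tmap_in.
by rewrite to_vertex_id in pq; rewrite (graph_idE pv pq).
Qed.

Lemma cgraph_hom y z (g : mor y z) a b a' b' : cgraph g a b -> cgraph g a' b' ->
  cgraph g (a + a') (b + b') /\ cgraph g (a ** a') (b ** b').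
Proof.
move=> [p [q [Tp <- pq Tq <-]]] [p' [q' [Tp' <- pq' Tq' <-]]].
have tD w c d : T w c -> T w d -> tm w (c + d) = tm w c + tm w d.
  by case: (tmap_iso gamma w) => _ tM Tc Td; case: (tM _ _ Tc Td).
have tM w c d : T w c -> T w d -> tm w (c ** d) = tm w c ** tm w d.
  by case: (tmap_iso gamma w) => _ tM Tc Td; case: (tM _ _ Tc Td).
split.
  exists (p + p'), (q + q'); split; rewrite ?tD //.
  - exact: (idealD (tdom_ideal gamma y)).
  - exact: (graphD pv pq pq').
  - exact: (idealD (tdom_ideal gamma z)).
exists (p ** p'), (q ** q'); split; rewrite ?tM //.
- exact: (idealM (tdom_ideal gamma y)).
- exact: (graphM pv pq pq').
- exact: (idealM (tdom_ideal gamma z)).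
Qed.

Lemma pinverse_tmap y c : T y c -> 'pinv_(fun=> 0) (T y) (tm y) (tm y c) = c.
Proof.
move=> Tc; rewrite pinvKV ?inE //.
by case: (tmap_iso gamma y) => -[].
Qed.

(** This trades the chosen inverse of [gamma_{tau_y}] and the nested domains for the two
    intermediate points of [cgraph]. *)
Lemma Ext_asetE y z (g : mor y z) b : ~ is_identity g ->
  aset (Ext gamma) g b <-> exists a, cgraph g a b.
Proof.
move=> ng; rewrite /aset /= /prange /Ext_pmap; case: pselect => // _ /=; split.
  move=> [_ [[[c Tc <-]]]] /=; rewrite pinverse_tmap // => -[Vc _] [Tz _] <-.
  by exists (tm y c), c; eexists; split.
move=> [a [c [d [Tc _ [Vc E] Td <-]]]]; exists (tm y c) => /=; last first.
  by rewrite pinverse_tmap // E.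
have yc : prange (tpmap gamma y) (tm y c) by exists c.
have ic : prange (pinverse (tpmap gamma y)) c.
  by exists (tm y c) => //=; rewrite pinverse_tmap.
rewrite pinverse_tmap // E; split=> //; split=> //.
by exists (tm y c) => /=; rewrite pinverse_tmap.
Qed.

Lemma Ext_amapE y z (g : mor y z) a b : cgraph g a b -> amap (Ext gamma) g a = b.
Proof.
move=> gab; rewrite /amap /= /Ext_pmap; case: pselect => [ig|ni] /=.
  by have [] := cgraph_identity ig gab.
have [c [d [Tc ca [Vc cd] Td db]]] := gab.
by rewrite /= -ca pinverse_tmap // cd.
Qed.

Lemma Ext_aset_id y : aset (Ext gamma) (idmor y) = I y.
Proof.
rewrite /aset /= /prange /Ext_pmap; case: pselect => [i1|[]]; last by [].
by rewrite /= image_id.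
Qed.

(** This is the shape in which [D_ideal] applies and in which units are found as images of
    intersections. *)
Lemma Ext_aset_eq y z (g : mor y z) : ~ is_identity g ->
  aset (Ext gamma) g = tm z @` (T z `&` (vact V (gx g) @`
               (T y `&` vset V (minv (gx g))))).
Proof.
move=> ng; apply/seteqP; split=> b.
  move=> /(Ext_asetE _ ng)[a [c [d [Tc _ [Vc E] Td <-]]]].
  by exists d => //; split=> //; exists c.
move=> [d [Td [c [Tc Vc] E]] <-]; apply/(Ext_asetE _ ng).
by exists (tm y c), c, d.
Qed.

Lemma Ext_partial_action : partial_action setT (Ext gamma).
Proof.
apply: (@partial_action_graph _ _ _ _ ext_graph).
- by move=> y; rewrite /oset Ext_aset_id; apply: Iset_ideal.
- move=> y z g; rewrite /oset Ext_aset_id.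
  have [[w]|ng] := pselect (is_identity g).
    by rewrite Ext_aset_id; apply: (ideal_refl (Iset_ideal gamma w)).
  by rewrite Ext_aset_eq //; apply: D_ideal.
- move=> y z g b; have [ig|ng] := pselect (is_identity g).
    split.
      by case: ig => w; rewrite Ext_aset_id => Ib; exists b; left.
    move=> [a [[_ <-]|/(cgraph_identity ig)[<-]]]; case: ig => w;
      by rewrite Ext_aset_id.
  rewrite Ext_asetE //; split=> -[a ga]; exists a; first by right.
  by case: ga => // -[].
- move=> y z g a b [[ig <- _]|]; last exact: Ext_amapE.
  by rewrite /amap /= /Ext_pmap; case: pselect.
- by move=> y a; rewrite /oset Ext_aset_id => Ia; left.
- move=> y z g a b [[ig <- Ia]|/cgraphV]; last by right.
  by left; split=> //; case: ig Ia => w //; rewrite minv1.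
(* An identity factor leaves the other factor unchanged; the remaining case composes two [cgraph]
   relations. *)
- move=> y z w g h a b c [[ih <- Ia]|hab].
    by case: ih g Ia => u g Ia; rewrite compm1.
  move=> [[ig <- Ib]|gbc]; last by right; apply: cgraph_comp gbc.
  by right; case: ig h hab Ib => u h hab Ib; rewrite comp1m.
- move=> y z g a b a' b' [[ig <- Ia]|gab].
    have iI := Iset_ideal gamma y.
    case=> [[_ <- Ia']|/(cgraph_identity ig)[<- Ia']]; split; left; split=> //;
      by [apply: (idealD iI) | apply: (idealM iI)].
  move=> [[ig <- Ia']|gab']; last first.
    by have [] := cgraph_hom gab gab'; split; right.
  have iI := Iset_ideal gamma y; have [<- Ia] := cgraph_identity ig gab.
  by split; left; split=> //; [apply: (idealD iI) | apply: (idealM iI)].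
Qed.

(** Since [tau_x] is an identity, [h_x = h] and [gamma_{tau_x}] is the identity of [I_x]. *)
Lemma Ext_aset_loop (h : mor x x) : aset (Ext gamma) h = vset V h.
Proof.
have Tx := tdom_base gamma.
have tx a : I x a -> tm x a = a by apply: tmap_base.
have Vsub (k : mor x x) : vset V k `<=` I x.
  rewrite -vdata_base.
  exact: (ideal_sub (@pa_ideal _ _ _ _ pv tt tt k)).
have [ih|nh] := pselect (is_identity h).
  by rewrite (is_identity_loop ih) Ext_aset_id vdata_base.
apply/seteqP; split=> b.
  move=> /(Ext_asetE _ nh)[a [c [d [Tc _ cd Td <-]]]].
  rewrite to_vertex_loop in cd; rewrite tx -?Tx //.
  exact: (graph_cod pv cd).
move=> /(graph_ex pv)[a ab]; apply/(Ext_asetE _ nh); exists a, a, b.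
have Ia : I x a by case: ab => /Vsub.
have Ib : I x b by have /Vsub := graph_cod pv ab.
by rewrite Tx !tx // to_vertex_loop.
Qed.

(** For [g = tau y] the vertex component [g_x] is an identity, so the composite reduces to
    [gamma_{tau_y}]. *)
Lemma Ext_aset_tr y : ~ is_identity (tau y) ->
  aset (Ext gamma) (tau y) = tm y @` T y.
Proof.
move=> nt; have Tx := tdom_base gamma.
have tx a : I x a -> tm x a = a by apply: tmap_base.
apply/seteqP; split=> b.
  by move=> /(Ext_asetE _ nt)[a [c [d [_ _ _ Td <-]]]]; exists d.
move=> [d Td <-]; apply/(Ext_asetE _ nt).
have Id : I x d by apply: (ideal_sub (tdom_ideal gamma y)).
exists d, d, d; rewrite Tx tx // to_vertex_tr; split=> //.
by apply: (graph_id pv); rewrite /oset; have := vdata_base gamma; rewrite /vset => ->.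
Qed.

End Extension.

Theorem proposition4p1 (G : groupoid) (hG : connected_groupoid G) (x : G)
    (tau : obj_transversal x) (A : rngType) (gamma : D_object tau A)
    (hI : forall y : G, unital (Iset gamma y)) :
  globalizable (Ext gamma) <->
  (globalizable (vdata gamma) /\ forall y : G, unital (tdom gamma y)).
Proof.
have Tx := tdom_base gamma; have pv := vdata_action gamma.
have pe := Ext_partial_action gamma.
have vo (y : vertex_group x) : oset (vdata gamma) y = Iset gamma x.
  by case: y; apply: vdata_base.
split.
  move=> /(globalizable_unital pe) ue.
  have {}ue y z (g : mor y z) : unital (aset (Ext gamma) g).
    by apply: ue => w; rewrite /oset Ext_aset_id.
  split.
    (* With a single object, the identity serves as the morphism to the base point. *)
    apply: (@unital_globalizable _ _ _ _ pv _ tt (fun=> idmor x)).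
    move=> [] [] h; have := ue _ _ (h : mor x x).
    by rewrite Ext_aset_loop.
  (* If [tau y] is an identity, then [y = x] and the ideal in question is [I_x], unital by
     assumption. *)
  move=> y; have [it|nt] := pselect (is_identity (tau y)).
    by rewrite -(is_identity_eq it) Tx.
  have [[_ tI _] tM] := tmap_iso gamma y.
  have iT := tdom_ideal gamma y.
  by apply: (unital_preimage iT _ tM tI) => //; rewrite -Ext_aset_tr.
move=> [/(globalizable_unital pv) uv uT].
have {}uv (h : mor x x) : unital (vset (vdata gamma) h).
  by apply: uv => y; rewrite vo.
apply: (@unital_globalizable _ _ _ _ pe _ x (fun y => minv (tau y))) => y z g.
have [[w]|ng] := pselect (is_identity g); first by rewrite Ext_aset_id.
have iV (h : mor x x) : ideal_of (vset (vdata gamma) h) (Iset gamma x).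
  rewrite -(vo tt).
  exact: (@pa_ideal _ _ _ _ pv tt tt h).
have uK : unital (tdom gamma y `&` vset (vdata gamma) (minv (to_vertex tau g))).
  exact: unitalI (tdom_ideal gamma y) (iV _) (uT y) (uv _).
have iso := @pa_iso _ _ _ _ pv tt tt (to_vertex tau g).
have iK := ideal_image (iV (minv (to_vertex tau g))) iso
  (ideal_capl (tdom_ideal gamma y) (iV _)).
rewrite Ext_aset_eq //; apply: unital_image.
  by case: (tmap_iso gamma z) => _; apply: hom_on_sub => a [].
have uvK : unital (vact (vdata gamma) (to_vertex tau g) @`
    (tdom gamma y `&` vset (vdata gamma) (minv (to_vertex tau g)))).
  by apply: unital_image uK; case: iso => _; apply: hom_on_sub => a [].
(* The image under [gamma_{g_x}] is a priori an ideal of [I_{g_x}] only; its unit makes it an ideal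
   of [I_x], as needed to intersect it with [I_{tau_z^{-1}}]. *)
apply: (unitalI (tdom_ideal gamma z) _ (uT z) uvK).
exact: unital_ideal_trans uvK iK (iV _).
Qed.
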